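(* Every deterministic preemptive online algorithm for $\textsc{Flow}$ has competitive ratio at least $\frac52-\sqrt2\approx1.086$.
   Context: $\textsc{Flow}$ with $p$ partitions: time is continuous from $0$; flow arrives at unit constant rate, so by time $t$ a total volume $t$ has arrived. At an unknown time $t_{max}\ge t_0$ ($t_0>0$ an arbitrarily small warm-up period) the flow stops, and separators $0=s_0\le s_1\le\dots\le s_{p-1}\le s_p=t_{max}$ must then be in place; the cost is $\max_j (s_{j+1}-s_j)$. In the preemptive online model separators can only be inserted at the current time and previously inserted separators may be removed. The competitive ratio is the supremum over $t_{max}$ of the cost divided by the optimal cost $t_{max}/p$. *)

(* Defs.v *)
From HB Require Import structures.
From mathcomp Require Import all_boot all_order all_algebra.
From mathcomp Require Import all_classical all_reals all_analysis.

Set Implicit Arguments.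
Unset Strict Implicit.
Unset Printing Implicit Defensive.

Import Order.TTheory GRing.Theory Num.Theory.
Local Open Scope classical_set_scope.
Local Open Scope ring_scope.

(* The sequence s_0 = 0, s_1, ..., s_{p-1}, s_p = t obtained from the p - 1
   interior separators. *)
Definition boundaries {R : realType} {p : nat} (t : R) (s : p.-1.-tuple R)
  : seq R := 0 :: rcons s t.

(* The neutral element 0 of the maximum is harmless: all gaps of a sorted
   sequence are nonnegative. *)
Definition cost {R : realType} {p : nat} (t : R) (s : p.-1.-tuple R) : R :=
  \big[Num.max/0]_(j < p)
    ((boundaries t s)`_j.+1 - (boundaries t s)`_j).

Definition opt_cost {R : realType} (p : nat) (t : R) : R := t / p%:R.

(* The only information revealed before the flow stops is the current time, so
   a deterministic online algorithm is a function of time: A t lists the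
   separators in place at time t, once the actions of time t are done, and these
   are the separators used if tmax = t. Only the values for t0 <= t matter.

   A separator at position s can only have been inserted at time s, so if it is
   in place at time t' it has been in place throughout [s, t']. Nothing else
   restricts insertion or removal. In particular, A t0 may be any p - 1 points
   of [0, t0], each inserted during the warm-up. An algorithm that uses
   fewer than p - 1 separators is covered by listing the current time t as many
   times as needed, which creates empty parts only. *)
Definition preemptive_online {R : realType} (p : nat) (t0 : R)
    (A : R -> p.-1.-tuple R) : Prop :=
  (forall t, t0 <= t -> sorted <=%R (boundaries t (A t))) /\
  (forall t t' s, t0 <= t -> t <= t' -> s \in A t' -> s <= t -> s \in A t).

Definition competitive_ratio {R : realType} (p : nat) (t0 : R)
    (A : R -> p.-1.-tuple R) : \bar R :=
  ereal_sup [set (cost t (A t) / opt_cost p t)%:E | t in [set t | t0 <= t]].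

(* Main.v *)
(* Compare the separators a at time T with the separators b at time s T, where
   s = sqrt 2, assuming all parts have size at most g = c T / p, resp. s g.
   Separators of b below T already occur in a, so a part of b lying in [0, T]
   is a union of q parts of a and has size at most g min(q, s), which is at most
   g ((2 - s) + (s - 1) q) for every natural number q. Summing bounds the length
   that the first k parts of b can cover using f parts of a; the remaining
   p - k - 1 parts of b, each of size at most s g, must cover the rest of
   [T, s T]. Eliminating k gives p (4 - 2 s) <= c (p + 3 - 2 s), which fails for
   c = 5/2 - s and p >= 3. For p = 2 the single separator would have to stay in
   place from T to s T, which is immediately impossible. *)

Require Import Defs.
From mathcomp Require Import all_boot all_order all_algebra.
From mathcomp Require Import all_classical all_reals all_analysis.
From mathcomp Require Import ring lra zify.
Import Order.TTheory GRing.Theory Num.Theory.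
Local Open Scope ring_scope.

Lemma telescope_le (R : realType) (a : nat -> R) (g : R) (p : nat) :
  (forall i, (i < p)%N -> a i.+1 - a i <= g) ->
  forall i j, (i <= j <= p)%N -> a j - a i <= g * (j%:R - i%:R).
Proof.
move=> ag i; elim=> [|j IHj] /andP[ij jp].
  by move: ij; rewrite leqn0 => /eqP ->; rewrite !subrr mulr0.
move: ij; rewrite leq_eqVlt => /predU1P[->|]; first by rewrite !subrr mulr0.
rewrite ltnS => ij.
have := IHj; rewrite ij ltnW // => /(_ isT) aji.
have := ag _ jp.
rewrite -(natr1 j) -addrA (addrC 1) addrA mulrDr mulr1; lra.
Qed.

Lemma sorted_bounded_merge (R : realType) (a b : nat -> R) (s g T : R)
    (p : nat) :
  1 <= s <= 2 -> 0 <= g -> a 0%N = 0 -> b 0%N = 0 ->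
  (forall i j, (i <= j <= p)%N -> a i <= a j) ->
  (forall i, (i < p)%N -> b i <= b i.+1) ->
  (forall i, (i < p)%N -> a i.+1 - a i <= g) ->
  (forall i, (i < p)%N -> b i.+1 - b i <= s * g) ->
  (forall i, (i <= p)%N -> b i <= T -> exists2 f, (f <= p)%N & a f = b i) ->
  forall k, (k <= p)%N -> b k <= T ->
  exists f, [/\ (f <= p)%N, a f = b k
              & b k <= g * ((2 - s) * k%:R + (s - 1) * f%:R)].
Proof.
move=> /andP[s1 s2] g0 a0 b0 amono bmono ag bg ba.
elim=> [_ _|k IHk kp bkT].
  by exists 0%N; split; rewrite ?a0 ?b0 // !mulr0 addr0 mulr0.
have bk := bmono _ kp; have bkg := bg _ kp.
have [f [fp afb bkle]] := IHk (ltnW kp) (le_trans bk bkT).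
have s2g : 0 <= g * (2 - s) by rewrite mulr_ge0 // subr_ge0.
have [h hp ahb] := ba _ kp bkT.
(* Repeated values in [a] allow [h <= f]. The new part is then empty, and keeping the index [f]
   preserves the bound, which a smaller index could break. *)
have [hf|fh] := leqP h f.
  exists f; have ahf : a h <= a f by apply: amono; rewrite hf.
  have bkE : b k.+1 = b k by lra.
  split=> //; first by rewrite bkE.
  rewrite bkE -natr1; lra.
exists h; split=> //.
have /= := telescope_le _ a g p ag f h; rewrite (ltnW fh) hp => /(_ isT) afh.
(* The affine weight [(2 - s) + (s - 1) q] equals 1 at q = 1, matching the bound [g] on one part of
   [a], and equals [s] at q = 2, where the bound [s * g] on a part of [b] takes over. *)
have [hE|fh2] : h = f.+1 \/ (f.+2 <= h)%N by clear -fh; lia.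
  move: afh; rewrite hE -!natr1 -ahb -hE; nra.
have : f%:R + 2 <= h%:R :> R by rewrite -natrD ler_nat addn2.
rewrite -natr1; move: (f%:R) (h%:R) bkle => F H bkle FH.
have : 0 <= g * (s - 1) * (H - F - 2).
  by rewrite !mulr_ge0 // subr_ge0 // lerBrDr addrC.
lra.
Qed.

Lemma sqrt2_bounds (R : realType) :
  [/\ Num.sqrt 2 * Num.sqrt 2 = 2 :> R, 7 / 5 <= Num.sqrt 2 :> R
    & Num.sqrt 2 <= 3 / 2 :> R].
Proof.
have ss : Num.sqrt 2 * Num.sqrt 2 = 2 :> R by rewrite -expr2 sqr_sqrtr.
have s0 : 0 <= Num.sqrt 2 :> R by exact: sqrtr_ge0.
by split=> //; nra.
Qed.

Lemma no_two_good_times (R : realType) (a b : nat -> R) (T g : R) (p : nat) :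
  let s := Num.sqrt 2 in
  (2 <= p)%N -> 0 < T -> g * p%:R = (5 / 2 - s) * T ->
  a 0%N = 0 -> b 0%N = 0 -> a p = T -> b p = s * T ->
  (forall i j, (i <= j <= p)%N -> a i <= a j) ->
  (forall i, (i < p)%N -> b i <= b i.+1) ->
  (forall i, (i < p)%N -> a i.+1 - a i <= g) ->
  (forall i, (i < p)%N -> b i.+1 - b i <= s * g) ->
  (forall i, (i <= p)%N -> b i <= T -> exists2 f, (f <= p)%N & a f = b i) ->
  False.
Proof.
move=> s p2 T0 gp a0 b0 ap bp amono bmono ag bg ba.
have [ss sl su] := sqrt2_bounds R; rewrite -/s in ss sl su.
have g0 : 0 <= g.
  have p0 : 0 < p%:R :> R by rewrite ltr0n; lia.
  rewrite -(pmulr_lge0 _ p0) gp; nra.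
have [pE|p3] : p = 2%N \/ (3 <= p)%N by lia.
  subst p.
  have b1 := bg 0%N isT; have b2 := bg 1%N isT; have a1 := ag 0%N isT.
  rewrite b0 subr0 in b1; rewrite bp in b2; rewrite a0 subr0 in a1.
  have gE : g = (5 / 4 - s / 2) * T by lra.
  have sgE : s * g = (5 / 4 * s - 1) * T.
    by rewrite gE mulrA; congr (_ * _); lra.
  have sgT : s * g < T by rewrite sgE; nra.
  (* If [b 1 = a 0 = 0], the second part has length [s * T > s * g]. If [b 1 = a 1 <= g], the end
     [s * T] is out of reach, as [g + s * g < s * T]. And [a 2 = T] exceeds [b 1]. *)
  have [[|[|[|f]]] // _ af] := ba 1%N isT (ltW (le_lt_trans b1 sgT)); nra.
have exk : exists k, (k <= p)%N && (b k <= T) by exists 0%N; rewrite b0 ltW.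
have ubk k : (k <= p)%N && (b k <= T) -> (k <= p)%N by case/andP.
case: (ex_maxnP exk ubk) => k /andP[kp bkT] kmax.
have kltp : (k < p)%N.
  rewrite ltn_neqAle kp andbT; apply/eqP => kE.
  move: bkT; rewrite kE bp; nra.
have BT : T < b k.+1.
  rewrite ltNge; apply/negP => BT.
  by have := kmax k.+1; rewrite kltp BT ltnn => /(_ isT).
have s12 : 1 <= s <= 2 by apply/andP; split; lra.
have [f [fp afb bkle]] :=
  sorted_bounded_merge _ _ _ _ _ _ _ s12 g0 a0 b0 amono bmono ag bg ba _ kp bkT.
have h2 : b p - b k.+1 <= s * g * (p%:R - k.+1%:R).
  by apply: (telescope_le _ b _ p bg); rewrite kltp leqnn.
have h3 := bg _ kltp.
have h4 : a p - a f <= g * (p%:R - f%:R).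
  by apply: (telescope_le _ a _ p ag); rewrite fp leqnn.
rewrite bp -(natr1 k) in h2; rewrite ap afb in h4.
have p3R : 3 <= p%:R :> R by rewrite ler_nat.
(* The part [b k, b k.+1] contains T and swallows p - f of the parts present at
   time T. *)
have straddle : (T - b k) + (s - 1) * (b k.+1 - T)
    <= g * ((2 - s) + (s - 1) * (p%:R - f%:R) + (3 - 2 * s)).
  (* The constant [3 - 2 * s] comes from [p = f.+1], the tight case: the left side is [(2 - s) (T -
     b k) + (s - 1) (b k.+1 - b k)], at most [(4 - 2 * s) * g]. *)
  have [pf|[pf|pf]] : p = f \/ p = f.+1 \/ (f.+2 <= p)%N by clear -fp; lia.
  - rewrite pf subrr mulr0 in h4; rewrite pf.
    have bkE : b k = T by lra.
    rewrite bkE in h3 *.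
    have : (s - 1) * (b k.+1 - T) <= (s - 1) * (s * g).
      by rewrite ler_wpM2l //; lra.
    have : s * s * g = 2 * g by rewrite ss.
    nra.
  - move: h4; rewrite pf -natr1 => h4.
    have : (s - 1) * (b k.+1 - b k) <= (s - 1) * (s * g).
      by rewrite ler_wpM2l //; lra.
    have : (2 - s) * (T - b k) <= (2 - s) * g.
      by rewrite ler_wpM2l //; lra.
    have : s * s * g = 2 * g by rewrite ss.
    lra.
  - have pf2 : f%:R + 2 <= p%:R :> R by rewrite -natrD ler_nat addn2.
    have : 0 <= g * (s - 1) * (p%:R - f%:R - 2).
      by rewrite !mulr_ge0 //; lra.
    have : 0 <= (2 - s) * (b k.+1 - T) by rewrite mulr_ge0 //; lra.
    have : 0 <= g * (3 - 2 * s) by rewrite mulr_ge0 //; lra.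
    lra.
(* Length beyond [T] is weighted by [s - 1] because [(s - 1) * s = 2 - s]: a part of [b] then counts
   the same before and after [T], and [k] cancels when [bkle], [straddle] and [h2'] are added. *)
have h2' : (s - 1) * (s * T - b k.+1)
    <= (s - 1) * (s * g * (p%:R - (k%:R + 1))).
  by rewrite ler_wpM2l //; lra.
have ssT : s * s * T = 2 * T by rewrite ss.
have ssg (x : R) : s * s * g * x = 2 * g * x by rewrite ss.
have main : T * (4 - 2 * s) <= g * p%:R + g * (3 - 2 * s).
  have := ssg p%:R; have := ssg k%:R; have := ssg 1; lra.
have : T * (4 - 2 * s) * p%:R <= (g * p%:R) * (p%:R + (3 - 2 * s)).
  have := ler_wpM2r (ler0n R p) main; lra.
rewrite gp => fin.
(* The choice of c gives [c (3 - 2 s) = (3 / 2 - s) (5 - 2 s)]. As [5 - 2 s] lies strictly between 2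
   and 3, this contradicts [p >= 3] but would not exclude [p = 2]. *)
have : T * ((3 / 2 - s) * (p%:R - (5 - 2 * s))) <= 0.
  by have := ssT; lra.
rewrite pmulr_rle0 //; nra.
Qed.

Section Boundaries.
Variables (R : realType) (p : nat) (t : R) (s : p.-1.-tuple R).
Hypothesis p_gt0 : (0 < p)%N.

Lemma size_boundaries : size (boundaries t s) = p.+1.
Proof. by rewrite /= size_rcons size_tuple prednK. Qed.

Lemma boundaries_last : (boundaries t s)`_p = t.
Proof.
by case: p p_gt0 s => // n _ u; rewrite /= nth_rcons size_tuple ltnn eqxx.
Qed.

Lemma le_nth_boundaries i j : sorted <=%R (boundaries t s) ->
  (i <= j <= p)%N -> (boundaries t s)`_i <= (boundaries t s)`_j.
Proof.
move=> srt /andP[ij jp]; apply: (sorted_leq_nth le_trans le_refl) => //.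
  by rewrite inE size_boundaries ltnS (leq_trans ij).
by rewrite inE size_boundaries ltnS.
Qed.

Lemma gap_le_cost i : (i < p)%N ->
  (boundaries t s)`_i.+1 - (boundaries t s)`_i <= cost t s.
Proof.
move=> ip; exact: (le_bigmax _ (fun j : 'I_p =>
  (boundaries t s)`_j.+1 - (boundaries t s)`_j) (Ordinal ip)).
Qed.

End Boundaries.

(** The online rule handles interior separators and 0 is common to both lists. The strict [t < t']
    keeps the final boundary [t'] from being [x]. *)
Lemma boundaries_subset (R : realType) (p : nat) (t0 t t' x : R)
    (A : R -> p.-1.-tuple R) :
  preemptive_online t0 A -> t0 <= t -> t < t' -> x <= t ->
  x \in boundaries t' (A t') -> x \in boundaries t (A t).
Proof.
move=> [_ online] t0t tt' xt; rewrite !inE !mem_rcons !inE.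
case/or3P=> [->//|/eqP xE|xA]; first by move: xt; rewrite xE leNgt tt'.
by rewrite (online _ _ _ t0t (ltW tt') xA xt) !orbT.
Qed.

Theorem theorem18 (R : realType) (p : nat) (hp : (2 <= p)%N) (t0 : R)
    (ht0 : 0 < t0) (A : R -> p.-1.-tuple R) (hA : preemptive_online t0 A) :
  ((5 / 2 - Num.sqrt 2)%:E <= competitive_ratio t0 A)%E.
Proof.
rewrite leNgt; apply/negP => ratio_lt.
have [ss sl su] := sqrt2_bounds R.
have p0 : (0 < p)%N by exact: ltn_trans hp.
have p0R : 0 < p%:R :> R by rewrite ltr0n.
set c := 5 / 2 - Num.sqrt 2 in ratio_lt.
have good t : t0 <= t -> cost t (A t) <= c * t / p%:R.
  move=> t0t.
  have : ((cost t (A t) / opt_cost p t)%:E <= competitive_ratio t0 A)%E.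
    by apply: ereal_sup_ubound; exists t.
  move=> /le_lt_trans/(_ ratio_lt); rewrite lte_fin /opt_cost.
  have tp0 : 0 < t / p%:R by rewrite divr_gt0 // (lt_le_trans ht0).
  by rewrite ltr_pdivrMr // mulrA => /ltW.
(* Two stopping times suffice, so T is taken to be [t0] itself, the earliest one allowed. *)
have t0s : t0 < Num.sqrt 2 * t0 by nra.
have good0 := good _ (lexx t0); have good1 := good _ (ltW t0s).
have [srt _] := hA.
have srt0 := srt _ (lexx t0); have srt1 := srt _ (ltW t0s).
apply: (no_two_good_times R (nth 0 (boundaries t0 (A t0)))
  (nth 0 (boundaries (Num.sqrt 2 * t0) (A (Num.sqrt 2 * t0))))
  t0 (c * t0 / p%:R) p hp ht0) => //.
- by rewrite divfK // gt_eqF.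
- exact: boundaries_last.
- exact: boundaries_last.
- by move=> i j; exact: le_nth_boundaries.
- by move=> i ip; apply: le_nth_boundaries => //; rewrite leqnSn.
- by move=> i ip; exact: le_trans (gap_le_cost _ _ _ _ _ ip) good0.
- move=> i ip; apply: le_trans (gap_le_cost _ _ _ _ _ ip) _.
  by apply: le_trans good1 _; rewrite mulrCA !mulrA.
- move=> i ip bT.
  have : nth 0 (boundaries (Num.sqrt 2 * t0) (A (Num.sqrt 2 * t0))) i
      \in boundaries t0 (A t0).
    apply: (boundaries_subset _ _ _ _ _ _ _ hA (lexx t0) t0s bT).
    by rewrite mem_nth // size_boundaries.
  by case/(nthP 0) => f; rewrite size_boundaries // ltnS => fp <-; exists f.
Qed.
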